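(* For each integer $n\ge 0$, let $a_n$ denote the number of tilings of an $8\times n$ board by $L$-tetrominoes (rotations allowed, reflections not allowed). Then the generating function is $\sum_{n\ge 0}a_nt^n=-A(t)/B(t)$, where \begin{align*} A(t) &= 4 t^{58}-5 t^{56}-69 t^{54}+34 t^{53}+36 t^{52}-28 t^{51}+334 t^{50}-194 t^{49}-181 t^{48}+196 t^{47}\\ &\qquad -560 t^{46} +356 t^{45}+490 t^{44}-396 t^{43}-22 t^{42}-114 t^{41}-240 t^{40}-44 t^{39}+1056 t^{38} \\ &\qquad -882 t^{37}-2511 t^{36} +1742 t^{35}-503 t^{34}+2046 t^{33}+9154 t^{32}-3982 t^{31}-2114 t^{30}\\ &\qquad -1838 t^{29}-16418 t^{28}+4992 t^{27} +4087 t^{26}+592 t^{25}+18004 t^{24}-3942 t^{23}-3377 t^{22}\\ &\qquad +80 t^{21}-12769 t^{20}+1978 t^{19}+1476 t^{18} -90 t^{17}+5910 t^{16}-602 t^{15}-344 t^{14}\\ &\qquad +20 t^{13} -1742 t^{12}+98 t^{11}+40 t^{10}-2 t^{9}+306 t^{8}-6 t^{7} -2 t^{6}-28 t^{4}+1 , \end{align*} and \begin{align*} B(t) &= 8 t^{62}-13 t^{60}-12 t^{59}-133 t^{58}+96 t^{57}+103 t^{56}+138 t^{55}+594 t^{54}-770 t^{53}-406 t^{52}\\ & \qquad -730 t^{51} -758 t^{50} +2786 t^{49}+820 t^{48}+2328 t^{47}-672 t^{46}-6010 t^{45}+118 t^{44}\\ &\qquad -5192 t^{43}+1900 t^{42}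 +7148 t^{41}-7274 t^{40}+9842 t^{39}+2695 t^{38}-3132 t^{37}\\ &\qquad +28144 t^{36}-16280 t^{35}-14647 t^{34} -854 t^{33}-59822 t^{32}+21412 t^{31}+24741 t^{30}\\ &\qquad -464 t^{29}+79992 t^{28}-20802 t^{27}-22589 t^{26} +2654 t^{25}-70203 t^{24}+14230 t^{23}\\ &\qquad +11727 t^{22}-1922 t^{21}+40915 t^{20}-6502 t^{19}-3185 t^{18} +498 t^{17}-15672 t^{16}\\ &\qquad +1834 t^{15}+278 t^{14}-10 t^{13}+3807 t^{12}-278 t^{11}+59 t^{10}-16 t^{9} -543 t^{8}+16 t^{7}\\ &\qquad -15 t^{6}+2 t^{5}+39 t^{4}+t^{2}-1. \end{align*} The first terms of the sequence $(a_n)_{n\ge 0}$ are $1, 0, 1, 0, 12, 2, 34, 14, 250, 114, 956, 694, 5864, 4428, 25805, 25554, \ldots$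
   Context: A $k\times n$ board is the rectangle of unit cells $\{(x,y)\in\mathbb{Z}^2: 0\le x<n,\ 0\le y<k\}$, where each cell is named by its bottom left corner. The $L$-tetromino tiles are the translates of the four sets (the rotations of the $L$-tetromino) \[\{(0,0),(0,1),(0,2),(1,0)\},\ \{(0,0),(0,1),(1,1),(2,1)\},\ \{(0,0),(1,0),(2,0),(2,1)\},\ \{(0,2),(1,0),(1,1),(1,2)\}.\] Reflections of these shapes are not allowed. A tiling of a board is a partition of its set of cells into such tiles (each tile may be used any number of times); two tilings are the same only if they are equal as partitions of the board (no identification under symmetries). The empty board ($n=0$) has exactly one tiling. Generating functions are formal power series in $t$ with rational coefficients. *)

(* Defs.v *)
From Stdlib Require Import BinNat.
From HB Require Import structures.
From mathcomp Require Import all_boot all_order all_algebra.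
From mathcomp Require Import boolp.

Set Implicit Arguments.
Unset Strict Implicit.
Unset Printing Implicit Defensive.

Import GRing.Theory.
Local Open Scope ring_scope.

(* The cell (x, y) of the k x n board has x < n and y < k. *)
Definition cell (k n : nat) : finType := ('I_n * 'I_k)%type.

Definition pos (k n : nat) (c : cell k n) : int * int :=
  (Posz c.1, Posz c.2).

Definition L_tetrominoes : seq (seq (int * int)) :=
  [:: [:: (0, 0); (0, 1); (0, 2); (1, 0)];
      [:: (0, 0); (0, 1); (1, 1); (2, 1)];
      [:: (0, 0); (1, 0); (2, 0); (2, 1)];
      [:: (0, 2); (1, 0); (1, 1); (1, 2)]].

(* Since T consists of cells of the board, the equality =i also says that the
   translate of s by v lies inside the board. *)
Definition is_tile (k n : nat) (T : {set cell k n}) : Prop :=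
  exists2 s : seq (int * int), s \in L_tetrominoes &
  exists v : int * int, [seq pos c | c in T] =i [seq v + p | p <- s].

Definition tilings (k n : nat) : {set {set {set cell k n}}} :=
  [set P | partition P [set: cell k n] & `[< forall T, T \in P -> is_tile T >]].

Definition num_tilings (k n : nat) : nat := #|tilings k n|.

(* Formal power series over rat, given by their coefficient sequences. *)
Definition fps : Type := nat -> rat.

Definition fps_of_poly (p : {poly rat}) : fps := fun n => p`_n.

Definition fps_mul (f g : fps) : fps :=
  fun n => \sum_(i < n.+1) f i * g (n - i)%N.

(* The first n coefficients of the multiplicative inverse of f; meaningful
   when f 0 != 0, see fps_mulV. *)
Fixpoint fps_inv_seq (f : fps) (n : nat) : seq rat :=
  if n is m.+1 then
    let s := fps_inv_seq f m in
    rcons s ((f 0)^-1 * ((m == 0)%:R - \sum_(i < m) s`_i * f (m - i)%N))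
  else [::].

Definition fps_inv (f : fps) : fps := fun n => (fps_inv_seq f n.+1)`_n.

Definition fps_div (f g : fps) : fps := fps_mul f (fps_inv g).

Lemma size_fps_inv_seq f n : size (fps_inv_seq f n) = n.
Proof. by elim: n => //= n IHn; rewrite size_rcons IHn. Qed.

Lemma nth_fps_inv_seq f n i : (i < n)%N -> (fps_inv_seq f n)`_i = fps_inv f i.
Proof.
elim: n => // n IHn; rewrite ltnS leq_eqVlt => /predU1P[-> // | lt_in].
by rewrite /= nth_rcons size_fps_inv_seq lt_in IHn.
Qed.

Lemma fps_mulV f : f 0 != 0 ->
  fps_mul f (fps_inv f) =1 fps_of_poly 1.
Proof.
move=> f0 n; rewrite /fps_mul /fps_of_poly coef1.
rewrite (reindex_inj rev_ord_inj) big_ord_recr /= subSS subnn subn0.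
rewrite {2}/fps_inv /= nth_rcons size_fps_inv_seq ltnn eqxx mulrA divff //.
rewrite mul1r addrC -[RHS]subr0 -addrA; congr (_ + _).
rewrite oppr0 addrC; apply/eqP; rewrite subr_eq0; apply/eqP.
apply: eq_bigr => i _; rewrite subSS subKn ?(ltnW (ltn_ord i)) // mulrC.
by rewrite nth_fps_inv_seq.
Qed.

(* The coefficients are binary numerals (type N): as unary natural numbers the
   largest of them are out of reach of the parser. *)
Local Notation "c *t^ e" := ((nat_of_bin c)%:R *: 'X^e)
  (at level 40, e at level 0, no associativity, only parsing).

Definition polyA : {poly rat} :=
  4 *t^ 58 - 5 *t^ 56 - 69 *t^ 54 + 34 *t^ 53 + 36 *t^ 52 - 28 *t^ 51
  + 334 *t^ 50 - 194 *t^ 49 - 181 *t^ 48 + 196 *t^ 47 - 560 *t^ 46 + 356 *t^ 45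
  + 490 *t^ 44 - 396 *t^ 43 - 22 *t^ 42 - 114 *t^ 41 - 240 *t^ 40 - 44 *t^ 39
  + 1056 *t^ 38 - 882 *t^ 37 - 2511 *t^ 36 + 1742 *t^ 35 - 503 *t^ 34 + 2046 *t^ 33
  + 9154 *t^ 32 - 3982 *t^ 31 - 2114 *t^ 30 - 1838 *t^ 29 - 16418 *t^ 28 + 4992 *t^ 27
  + 4087 *t^ 26 + 592 *t^ 25 + 18004 *t^ 24 - 3942 *t^ 23 - 3377 *t^ 22 + 80 *t^ 21
  - 12769 *t^ 20 + 1978 *t^ 19 + 1476 *t^ 18 - 90 *t^ 17 + 5910 *t^ 16 - 602 *t^ 15
  - 344 *t^ 14 + 20 *t^ 13 - 1742 *t^ 12 + 98 *t^ 11 + 40 *t^ 10 - 2 *t^ 9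
  + 306 *t^ 8 - 6 *t^ 7 - 2 *t^ 6 - 28 *t^ 4 + 1.

Definition polyB : {poly rat} :=
  8 *t^ 62 - 13 *t^ 60 - 12 *t^ 59 - 133 *t^ 58 + 96 *t^ 57 + 103 *t^ 56
  + 138 *t^ 55 + 594 *t^ 54 - 770 *t^ 53 - 406 *t^ 52 - 730 *t^ 51 - 758 *t^ 50
  + 2786 *t^ 49 + 820 *t^ 48 + 2328 *t^ 47 - 672 *t^ 46 - 6010 *t^ 45 + 118 *t^ 44
  - 5192 *t^ 43 + 1900 *t^ 42 + 7148 *t^ 41 - 7274 *t^ 40 + 9842 *t^ 39 + 2695 *t^ 38
  - 3132 *t^ 37 + 28144 *t^ 36 - 16280 *t^ 35 - 14647 *t^ 34 - 854 *t^ 33 - 59822 *t^ 32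
  + 21412 *t^ 31 + 24741 *t^ 30 - 464 *t^ 29 + 79992 *t^ 28 - 20802 *t^ 27 - 22589 *t^ 26
  + 2654 *t^ 25 - 70203 *t^ 24 + 14230 *t^ 23 + 11727 *t^ 22 - 1922 *t^ 21 + 40915 *t^ 20
  - 6502 *t^ 19 - 3185 *t^ 18 + 498 *t^ 17 - 15672 *t^ 16 + 1834 *t^ 15 + 278 *t^ 14
  - 10 *t^ 13 + 3807 *t^ 12 - 278 *t^ 11 + 59 *t^ 10 - 16 *t^ 9 - 543 *t^ 8
  + 16 *t^ 7 - 15 *t^ 6 + 2 *t^ 5 + 39 *t^ 4 + 1 *t^ 2 - 1.

Lemma polyB_coef0 : fps_of_poly polyB 0 = -1.
Proof.
have coef0Z (c : rat) (e : nat) : (0 == e)%N = false -> (c *: 'X^e)`_0 = 0.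
  by move=> e0; rewrite coefZ coefXn e0 mulr0.
rewrite /fps_of_poly /polyB !(coefD, coefN) coef1.
by rewrite !coef0Z //  !(oppr0, addr0, add0r).
Qed.

(* Main.v *)
(* The cells of the board are numbered column by column, and a tiling is built
   by always covering the first free cell.  Eight such steps fill a column, so
   the number of completions of a partially covered board depends only on the
   remaining number of columns and on the cells protruding into them; 227 such
   states are reachable from the empty one.  The vectors v_k, giving the number
   of completions of each state with k columns left, satisfy v_(k+1) = M v_k,
   and it turns out that sum_e b_e v_(63-e) = 0 for the coefficients b_e of B.
   Applying M^k gives sum_e b_e v_(k+63-e) = 0 for all k, so the coefficients
   of B(t) sum_n a_n t^n vanish from t^63 on, and only the earlier ones have to
   be compared with those of -A(t). *)

Require Import Defs.
From Stdlib Require Import BinNat Nnat BinInt.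
From mathcomp Require Import all_boot all_order all_algebra.
From mathcomp Require Import boolp zify ssrZ.

Set Implicit Arguments.
Unset Strict Implicit.
Unset Printing Implicit Defensive.

Import GRing.Theory.
Local Open Scope ring_scope.

(** * Counting exact covers by blocks of a family *)

Section ExactCover.
Local Open Scope nat_scope.
Variables (T : finType) (F : {set {set T}}).

Definition covers (U : {set T}) : {set {set {set T}}} :=
  [set P | partition P U & P \subset F].

Lemma card_covers0 : #|covers set0| = 1.
Proof.
rewrite -(cards1 (set0 : {set {set T}})); congr #|pred_of_set _|.
apply/setP=> P; rewrite !inE partition_set0.
by apply: andb_idr => /eqP ->; exact: sub0set.
Qed.

(** Deleting [B] from a partition and putting it back are mutually inverse: [B] is never a block of
    a cover of [U :\: B], because it contains [x]. *)
Lemma card_covers_fiber (U B : {set T}) (x : T) :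
    B \in F -> x \in B -> B \subset U ->
  #|[set P in covers U | pblock P x == B]| = #|covers (U :\: B)|.
Proof.
move=> BF xB BU.
have B0 : B != set0 by apply/set0Pn; exists x.
have BNQ Q : Q \in covers (U :\: B) -> B \notin Q.
  rewrite inE => /andP[Qp _]; apply/negP => BQ.
  have /setP/(_ x) := cover_partition Qp.
  rewrite !inE xB /= => /negP; apply.
  by apply/bigcupP; exists B.
suff -> : [set P in covers U | pblock P x == B] =
          (setU [set B]) @: covers (U :\: B).
  apply: card_in_imset => Q1 Q2 /BNQ B1 /BNQ B2 E.
  by rewrite -(setU1K B1) E setU1K.
apply/setP => P; apply/idP/imsetP => [|[Q QU ->]].
  rewrite !inE => /andP[/andP[Pp PF] /eqP Px].
  have BP : B \in P.
    by rewrite -Px pblock_mem // (cover_partition Pp) (subsetP BU).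
  exists (P :\ B); last by rewrite setD1K.
  by rewrite inE partitionD1 //= (subset_trans (subsetDl _ _)).
have BQ := BNQ _ QU; move: QU; rewrite !inE => /andP[Qp QF].
have Up : partition (B |: Q) U.
  rewrite -(setID U B) (setIidPr BU); apply: partitionU1 => //.
  by rewrite -setI_eq0 setIDA (setIidPl BU) setDv.
rewrite Up subUset sub1set BF QF /=; apply/eqP.
by apply: def_pblock => //; [exact: partition_trivIset Up | rewrite setU11].
Qed.

(** The covers are sorted by their block through [x]. *)
Lemma card_covers_rec (U : {set T}) (x : T) : x \in U ->
  #|covers U| = \sum_(B in F | (x \in B) && (B \subset U)) #|covers (U :\: B)|.
Proof.
move=> xU; rewrite -sum1_card.
rewrite (partition_big (fun P => pblock P x)
          (fun B => (B \in F) && ((x \in B) && (B \subset U)))) /=; last first.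
  move=> P; rewrite inE => /andP[Pp PF].
  have xP : x \in cover P by rewrite (cover_partition Pp).
  rewrite (subsetP PF) ?pblock_mem // mem_pblock xP /=.
  by rewrite -(cover_partition Pp) (bigcup_max (pblock P x)) ?pblock_mem.
apply: eq_bigr => B /and3P[BF xB BU].
rewrite -(card_covers_fiber BF xB BU) -sum1_card.
by apply: eq_bigl => P; rewrite !inE.
Qed.

End ExactCover.

(** * Sets of cells as binary numerals, and placing tiles on them *)

Definition bit (w : N) (j : nat) : bool := N.testbit w (N.of_nat j).

Definition mask (s : seq nat) : N :=
  foldr (fun j w => N.setbit w (N.of_nat j)) 0%num s.

Lemma bit0 j : bit 0%num j = false.
Proof. by case: j. Qed.

Lemma bit_div2 w j : bit (N.div2 w) j = bit w j.+1.
Proof. by rewrite /bit N.testbit_div2 Nat2N.inj_succ. Qed.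

Lemma bit_lor w w' j : bit (N.lor w w') j = bit w j || bit w' j.
Proof. by rewrite /bit N.lor_spec. Qed.

Lemma bit_mask s j : bit (mask s) j = (j \in s).
Proof.
elim: s => [|k s IHs] //=.
rewrite /bit N.setbit_eqb -/(bit _ _) IHs inE eq_sym; congr (_ || _).
by apply/N.eqb_spec/eqP => [/Nat2N.inj|->].
Qed.

(** With [m] cells left, this is the test that no covered cell of the state [w] lies beyond the end
    of the board. *)
Lemma div2_iter_eq0P m w :
  reflect (forall j, (m <= j)%N -> bit w j = false) (iter m N.div2 w == 0%num).
Proof.
elim: m w => [|m IHm] w; last rewrite iterSr.
  apply: (iffP eqP) => /= [-> j _|w0]; first exact: bit0.
  apply: N.bits_inj => j; rewrite -(N2Nat.id j); exact: w0.
apply: (iffP (IHm _)) => w0 j mj.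
  by case: j mj => // j mj; rewrite -bit_div2 w0.
by rewrite bit_div2 w0.
Qed.

(* Each row describes a tile by the offsets of its cells, in the numbering
   8x + y of the board, from the first of them; the boolean says whether the
   tile fits vertically when its first cell lies in row y. *)
Definition tile_table (y : nat) : seq (bool * seq nat) :=
  [:: ((y <= 5)%N, [:: 0; 1; 2; 8]%N); ((y <= 6)%N, [:: 0; 1; 9; 17]%N);
      ((y <= 6)%N, [:: 0; 8; 16; 17]%N); ((2 <= y)%N, [:: 0; 6; 7; 8]%N)].

Definition tiles_from (y : nat) : seq (seq nat) :=
  [seq t.2 | t <- tile_table y & t.1].

Lemma tiles_fromP y t :
  reflect (exists2 b : bool, b & (b, t) \in tile_table y) (t \in tiles_from y).
Proof.
apply: (iffP mapP) => [[[b t']]|[b bT bt]].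
  by rewrite mem_filter => /andP[/= bT bt ->]; exists b.
by exists (b, t) => [|//]; rewrite mem_filter; apply/andP.
Qed.

Lemma tiles_from_sorted y t : t \in tiles_from y -> sorted ltn t.
Proof.
case/tiles_fromP=> b _; rewrite /tile_table !inE !xpair_eqE.
by case/or4P => /andP[_ /eqP->].
Qed.

Lemma tiles_from0 y t : t \in tiles_from y -> 0%N \in t.
Proof.
case/tiles_fromP=> b _; rewrite /tile_table !inE !xpair_eqE.
by case/or4P => /andP[_ /eqP->].
Qed.

Lemma tiles_from_uniq y : uniq (tiles_from y).
Proof. by apply: (subseq_uniq (map_subseq _ (filter_subseq _ _))). Qed.

(** Bit 0 stands for the current cell, and halving moves on to the next one. A free current cell
    must be the first cell of its tile, since all earlier cells are covered. *)
Definition step (y : nat) (w : N) : seq N :=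
  if bit w 0%N then [:: N.div2 w]
  else [seq N.div2 (N.lor w (mask t)) | t <- tiles_from y & ~~ has (bit w) t].

(* The bits of w mark the covered cells among the last m cells of the board;
   the next cell, number 8n - m, lies in row 7 - (m - 1) %% 8. *)
Fixpoint completions (m : nat) (w : N) : nat :=
  if m is m'.+1 then \sum_(q <- step (7 - m' %% 8) w) completions m' q
  else (w == 0%num).

(** * Correctness of the cell-by-cell count *)

Section Board.
Variable n : nat.
Local Open Scope nat_scope.

Definition tile_set : {set {set cell 8 n}} := [set T | `[< is_tile T >]].

Lemma num_tilings_covers : num_tilings 8 n = #|covers tile_set [set: cell 8 n]|.
Proof.
congr #|pred_of_set _|; apply/setP=> P; rewrite !inE; congr (_ && _).
apply/asboolP/subsetP => PF T /PF; first by rewrite inE => ?; apply/asboolP.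
by rewrite inE => /asboolP.
Qed.

Definition index_of (c : cell 8 n) : nat := 8 * c.1 + c.2.

Lemma index_of_lt c : index_of c < 8 * n.
Proof. by case: c => [[x ?] [y ?]]; rewrite /index_of /=; lia. Qed.

Lemma index_of_surj k : k < 8 * n -> {c | index_of c = k}.
Proof.
move=> kn; have hx : k %/ 8 < n by lia.
have hy : k %% 8 < 8 by lia.
by exists (Ordinal hx, Ordinal hy); rewrite /index_of /=; lia.
Qed.

Definition uncovered (i : nat) (w : N) : {set cell 8 n} :=
  [set c | (i <= index_of c) && ~~ bit w (index_of c - i)].

Definition tile_at (i : nat) (t : seq nat) : {set cell 8 n} :=
  [set c | (i <= index_of c) && (index_of c - i \in t)].

Definition fits (i : nat) (t : seq nat) : bool :=
  all (fun j => i + j < 8 * n) t.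

Lemma pos_inj : injective (@pos 8 n).
Proof. by move=> [x y] [x' y'] [/val_inj-> /val_inj->]. Qed.

(** This separates the shape of a tile from the condition that the translate stays on the board,
    which leaves only linear arithmetic below. *)
Lemma is_tileE (T : {set cell 8 n}) : is_tile T <->
  exists2 s, s \in L_tetrominoes & exists v : int * int,
    (forall c, (c \in T) = (pos c \in [seq (v + p)%R | p <- s])) /\
    (forall p, p \in s -> exists c : cell 8 n, pos c = (v + p)%R).
Proof.
split=> -[s sL [v]] => [E|[TE Ts]]; exists s => //; exists v.
  split=> [c|p ps]; first by rewrite -E mem_image //; exact: pos_inj.
  have : (v + p)%R \in [seq pos c | c in T] by rewrite E map_f.
  by case/imageP=> c _ ->; exists c.
move=> u; apply/imageP/mapP => [[c cT ->]|[p ps ->]].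
  by apply/mapP; rewrite -TE.
by have [c cE] := Ts p ps; exists c; rewrite // TE cE map_f.
Qed.

(** The cell of least index in a shape does not depend on the translation, so it must land on [c0];
    this determines the translation, hence the offsets. *)
Lemma tile_at_uniq c0 T : is_tile T -> c0 \in T ->
    (forall c, c \in T -> index_of c0 <= index_of c) ->
  exists2 t, t \in tiles_from c0.2 &
    fits (index_of c0) t /\ T = tile_at (index_of c0) t.
Proof.
case/is_tileE=> s sL [[vx vy] [TE Ts]].
have posE c (p : int * int) : (pos c == ((vx, vy) + p)%R) =
    ((Posz c.1 == vx + p.1)%R && (Posz c.2 == vy + p.2)%R) by [].
move=> c0T c0min.
have {}Ts p : p \in s -> exists x y : nat, [/\ x < n, y < 8,
    Posz x = (vx + p.1)%R, Posz y = (vy + p.2)%R & index_of c0 <= 8 * x + y].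
  move=> ps; have [c cE] := Ts p ps.
  have cT : c \in T by rewrite TE cE map_f.
  move/eqP: cE; rewrite posE => /andP[/eqP cx /eqP cy].
  by exists c.1, c.2; split=> //; exact: c0min.
have {}TE c : (c \in T) =
    has (fun p => (Posz c.1 == vx + p.1)%R && (Posz c.2 == vy + p.2)%R) s.
  rewrite TE; elim: (s) => //= p s' IHs.
  by rewrite inE IHs posE.
have y0_lt := ltn_ord c0.2.
have Teq t : (forall x y, x < n -> y < 8 ->
     has (fun p => (Posz x == vx + p.1)%R && (Posz y == vy + p.2)%R) s =
     (index_of c0 <= 8 * x + y) && (8 * x + y - index_of c0 \in t)) ->
   T = tile_at (index_of c0) t.
  move=> E; apply/setP=> c; rewrite TE inE; exact: E.
move: c0T; rewrite TE {TE c0min}.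
case: c0 y0_lt Ts Teq => x0 y0 /= y0_lt.
rewrite /index_of /=.
move: sL; rewrite !inE => /or4P[]/eqP-> /= Ts Teq c0T.
(* In each case three cells suffice: they include the first cell of the shape and reach its extreme
   rows and its last column. *)
- have /= [xa [ya [? ? ? ? ?]]] := Ts (0, 0)%R isT.
  have /= [xb [yb [? ? ? ? ?]]] := Ts (0, 2)%R isT.
  have /= [xc [yc [? ? ? ? ?]]] := Ts (1, 0)%R isT.
  have ? : vx = x0 by lia.
  have ? : vy = y0 by lia.
  exists [:: 0; 1; 2; 8]; first apply/tiles_fromP.
    by exists (y0 <= 5); [lia | rewrite /tile_table !inE eqxx ?orbT].
  split; first by rewrite /fits /=; lia.
  apply: Teq => x y ? ?; rewrite !inE; lia.
- have /= [xa [ya [? ? ? ? ?]]] := Ts (0, 0)%R isT.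
  have /= [xb [yb [? ? ? ? ?]]] := Ts (0, 1)%R isT.
  have /= [xc [yc [? ? ? ? ?]]] := Ts (2, 1)%R isT.
  have ? : vx = x0 by lia.
  have ? : vy = y0 by lia.
  exists [:: 0; 1; 9; 17]; first apply/tiles_fromP.
    by exists (y0 <= 6); [lia | rewrite /tile_table !inE eqxx ?orbT].
  split; first by rewrite /fits /=; lia.
  apply: Teq => x y ? ?; rewrite !inE; lia.
- have /= [xa [ya [? ? ? ? ?]]] := Ts (0, 0)%R isT.
  have /= [xb [yb [? ? ? ? ?]]] := Ts (2, 0)%R isT.
  have /= [xc [yc [? ? ? ? ?]]] := Ts (2, 1)%R isT.
  have ? : vx = x0 by lia.
  have ? : vy = y0 by lia.
  exists [:: 0; 8; 16; 17]; first apply/tiles_fromP.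
    by exists (y0 <= 6); [lia | rewrite /tile_table !inE eqxx ?orbT].
  split; first by rewrite /fits /=; lia.
  apply: Teq => x y ? ?; rewrite !inE; lia.
(* In this shape the first cell in column order is (0, 2), so the translation is by [y0 - 2]
   vertically. *)
- have /= [xa [ya [? ? ? ? ?]]] := Ts (0, 2)%R isT.
  have /= [xb [yb [? ? ? ? ?]]] := Ts (1, 0)%R isT.
  have /= [xc [yc [? ? ? ? ?]]] := Ts (1, 2)%R isT.
  have ? : vx = x0 by lia.
  have ? : (vy + 2)%R = y0 by lia.
  exists [:: 0; 6; 7; 8]; first apply/tiles_fromP.
    by exists (2 <= y0); [lia | rewrite /tile_table !inE eqxx ?orbT].
  split; first by rewrite /fits /=; lia.
  apply: Teq => x y ? ?; rewrite !inE; lia.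
Qed.

Lemma tile_at_is_tile (c0 : cell 8 n) t :
    t \in tiles_from c0.2 -> fits (index_of c0) t ->
  is_tile (tile_at (index_of c0) t).
Proof.
case: c0 => x0 y0 /tiles_fromP[b /= bT bt] ft.
have y0_lt := ltn_ord y0.
(* It is enough to match offsets with coordinates and to bound the coordinates over the integers. *)
suff [s sL [vx [vy [tE tB]]]] : exists2 s, s \in L_tetrominoes &
    exists vx vy : int,
    (forall x y, x < n -> y < 8 ->
     (index_of (x0, y0) <= 8 * x + y) && (8 * x + y - index_of (x0, y0) \in t) =
     has (fun p => (Posz x == vx + p.1)%R && (Posz y == vy + p.2)%R) s) /\
    all (fun p => [&& 0 <= vx + p.1, vx + p.1 < Posz n,
                      0 <= vy + p.2 & vy + p.2 < 8]%R) s.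
  apply/is_tileE; exists s => //; exists (vx, vy); split=> [c|p /(allP tB)].
    rewrite inE tE //; elim: (s) => //= p s' IHs.
    by rewrite inE IHs.
  move=> /and4P[x0P xn y0P y8].
  have hx : absz (vx + p.1)%R < n by rewrite -ltz_nat gez0_abs.
  have hy : absz (vy + p.2)%R < 8 by rewrite -ltz_nat gez0_abs.
  exists (Ordinal hx, Ordinal hy).
  by rewrite /pos /= !gez0_abs.
move: ft bT; rewrite /index_of /=.
move: bt; rewrite /tile_table !inE !xpair_eqE => /or4P[] /andP[/eqP-> /eqP->];
  rewrite /fits /= => ft bT.
- exists [:: (0, 0); (0, 1); (0, 2); (1, 0)]%R; first by rewrite inE.
  exists (Posz x0), (Posz y0).
  by split=> [x y ? ?|] /=; rewrite ?inE; lia.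
- exists [:: (0, 0); (0, 1); (1, 1); (2, 1)]%R; first by rewrite inE.
  exists (Posz x0), (Posz y0).
  by split=> [x y ? ?|] /=; rewrite ?inE; lia.
- exists [:: (0, 0); (1, 0); (2, 0); (2, 1)]%R; first by rewrite inE.
  exists (Posz x0), (Posz y0).
  by split=> [x y ? ?|] /=; rewrite ?inE; lia.
- exists [:: (0, 2); (1, 0); (1, 1); (1, 2)]%R; first by rewrite inE.
  exists (Posz x0), (Posz y0 - 2)%R.
  by split=> [x y ? ?|] /=; rewrite ?inE; lia.
Qed.

(** When [t] fits, each of its offsets is attained by a cell of the board, so the offsets can be
    read off the set of cells. *)
Lemma tile_at_inj i t t' : fits i t -> fits i t' ->
  tile_at i t = tile_at i t' -> t =i t'.
Proof.
suff H u u' : fits i u -> tile_at i u = tile_at i u' -> {subset u <= u'}.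
  by move=> ft ft' E j; apply/idP/idP; apply: H.
move=> /allP fu /setP E j ju; have [c ci] := index_of_surj (fu j ju).
by have := E c; rewrite !inE ci leq_addr addKn ju.
Qed.

Lemma tile_at_sub i t w : fits i t ->
  (tile_at i t \subset uncovered i w) = ~~ has (bit w) t.
Proof.
move=> /allP ft; rewrite -all_predC; apply/subsetP/allP => [sub j jt|wt c].
  have [c ci] := index_of_surj (ft j jt).
  by have := sub c; rewrite !inE ci leq_addr addKn => /(_ jt).
by rewrite !inE => /andP[-> /wt].
Qed.

(** No uncovered cell precedes [c0], so a tile through [c0] within the uncovered cells has [c0] as
    its first cell and comes from a unique row of the table. *)
Lemma sum_tiles_from (c0 : cell 8 n) w (G : {set cell 8 n} -> nat) :
  \sum_(T in tile_set | (c0 \in T) && (T \subset uncovered (index_of c0) w)) G T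
  = \sum_(t <- tiles_from c0.2 | fits (index_of c0) t && ~~ has (bit w) t)
      G (tile_at (index_of c0) t).
Proof.
set i := index_of c0.
rewrite -[RHS]big_filter -(big_map (tile_at i) xpredT G) big_uniq /=;
  last first.
  rewrite map_inj_in_uniq ?filter_uniq ?tiles_from_uniq // => t t'.
  rewrite !mem_filter => /andP[/andP[ft _] ty] /andP[/andP[ft' _] ty'].
  (* Offset lists are strictly increasing, so having the same members makes them equal. *)
  move=> /(tile_at_inj ft ft'); apply: (irr_sorted_eq ltn_trans ltnn).
  - exact: tiles_from_sorted ty.
  - exact: tiles_from_sorted ty'.
apply: eq_bigl => T; rewrite !inE; apply/and3P/mapP => [[/asboolP Tt cT TU]|].
  have [|t ty [ft TE]] := tile_at_uniq Tt cT.
    by move=> c /(subsetP TU); rewrite inE => /andP[].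
  by exists t; rewrite // mem_filter ty ft -(tile_at_sub _ ft) -TE TU.
case=> t; rewrite mem_filter => /andP[/andP[ft wt] ty] ->.
split; first by apply/asboolP; exact: tile_at_is_tile.
  by rewrite inE leqnn subnn (tiles_from0 ty).
by rewrite tile_at_sub.
Qed.

Lemma uncovered_behead i w : bit w 0 ->
  uncovered i.+1 (N.div2 w) = uncovered i w.
Proof.
move=> w0; apply/setP=> c; rewrite !inE bit_div2.
case: (ltngtP i (index_of c)) => [ic|//|<-]; last by rewrite subnn w0.
by rewrite -subSn.
Qed.

Lemma uncovered_tile i w t : 0 \in t ->
  uncovered i.+1 (N.div2 (N.lor w (mask t))) = uncovered i w :\: tile_at i t.
Proof.
move=> t0; apply/setP=> c; rewrite !inE bit_div2 bit_lor bit_mask.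
case: (ltngtP i (index_of c)) => [ic|//|<-]; last by rewrite subnn t0.
by rewrite -subSn //= subSS negb_or andbC.
Qed.

(** [completions] lets tiles stick out past the right end and rejects them only by its final zero
    test. Hence the invariant: a protruding state counts 0, and any other state counts the covers of
    its free cells, by sorting them by the tile on cell [i]. *)
Lemma completionsE m i w : i + m = 8 * n ->
  completions m w =
  if iter m N.div2 w == 0%num then #|covers tile_set (uncovered i w)| else 0.
Proof.
elim: m i w => [|m IHm] i w im.
  rewrite /=; case: eqP => // _.
  rewrite (_ : uncovered i w = set0) ?card_covers0 //.
  apply/setP=> c; rewrite !inE; have := index_of_lt c; lia.
have [c0 c0i] : {c : cell 8 n | index_of c = i} by apply: index_of_surj; lia.
have -> : completions m.+1 w = \sum_(q <- step c0.2 w) completions m q.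
  rewrite [LHS]/=; congr (\sum_(q <- step _ _) _).
  by move: c0i (ltn_ord c0.2); rewrite /index_of; lia.
under eq_bigr do rewrite (IHm i.+1) ?addSnnS //.
rewrite /step; case: ifP => w0.
  by rewrite big_seq1 -iterSr uncovered_behead.
rewrite big_map big_filter.
(* Placing a tile only adds bits, so a protruding state has only protruding successors. *)
case: (div2_iter_eq0P m.+1 w) => [wm|/div2_iter_eq0P wm]; last first.
  rewrite big1 // => t _; rewrite -iterSr; case: (div2_iter_eq0P m.+1) => // tm.
  case/negP: wm; apply/div2_iter_eq0P => j /tm.
  by rewrite bit_lor => /norP[/negbTE].
rewrite (@card_covers_rec _ _ _ c0); last by rewrite inE c0i leqnn subnn w0.
rewrite -c0i sum_tiles_from c0i big_seq_cond [RHS]big_seq_cond.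
rewrite big_mkcond [RHS]big_mkcond; apply: eq_bigr => t _.
case ty: (t \in _) => //=; case: has => /=; rewrite ?andbF ?andbT //.
rewrite uncovered_tile ?(tiles_from0 ty) // -iterSr.
(* As [w] does not protrude, the new state does so exactly when the tile does not fit. *)
congr (if _ then _ else _); apply/div2_iter_eq0P/allP => [tm j jt|ft j mj].
  rewrite ltnNge; apply/negP => ij.
  have mj : m < j by lia.
  by have := tm j mj; rewrite bit_lor bit_mask jt orbT.
rewrite bit_lor bit_mask wm //=; apply/negP => /ft; lia.
Qed.

End Board.

Lemma num_tilingsE n : num_tilings 8 n = completions (8 * n)%N 0%num.
Proof.
rewrite num_tilings_covers (completionsE _ (add0n _)).
case: div2_iter_eq0P => [_|[j _]]; last exact: bit0.
by congr #|pred_of_set (covers _ _)|.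
Qed.

(** * The transfer matrix for one column *)

Definition step_all (ws : seq N) (y : nat) : seq N :=
  flatten [seq step y w | w <- ws].

(** A state is repeated once for every way of reaching it, so the list is a row of the transfer
    matrix with its multiplicities. *)
Definition advance (w : N) : seq N := foldl step_all [:: w] (iota 0 8).

Lemma sum_completions_foldl k j ws : (j <= 8)%N ->
  (\sum_(w <- ws) completions (8 * k + j) w =
   \sum_(w <- foldl step_all ws (iota (8 - j) j)) completions (8 * k) w)%N.
Proof.
elim: j ws => [|j IHj] ws j8; first by rewrite addn0.
rewrite addnS /= subnSK // -IHj ?(ltnW j8) // big_flatten big_map.
by apply: eq_bigr => w _; rewrite (_ : 7 - _ = 8 - j.+1)%N //; lia.
Qed.

Lemma completions_advance k w :
  (completions (8 * k.+1) w = \sum_(q <- advance w) completions (8 * k) q)%N.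
Proof.
by rewrite /advance -(@sum_completions_foldl k 8) // big_seq1 mulnS addnC.
Qed.

(** The bound 30 need not be justified beforehand: [states_closed] checks that the resulting list is
    closed under [advance]. *)
Definition states : seq N := Eval vm_compute in
  iter 30 (fun s => undup (N0 :: s ++ flatten [seq advance w | w <- s])) [::].

Definition successors : seq (seq nat) := Eval vm_compute in
  [seq [seq index q states | q <- advance w] | w <- states].

Lemma successorsE :
  successors = [seq [seq index q states | q <- advance w] | w <- states].
Proof. by vm_compute. Qed.

Lemma states_closed w : w \in states -> {subset advance w <= states}.
Proof.
move=> ws; apply/allP.
by apply: (allP (_ : all (fun w => all (mem states) (advance w)) states)) w ws;
  vm_compute.
Qed.

Local Opaque states successors.

(** Values in [Z] allow negative coefficients and binary computation. *)
Definition completionsZ (k : nat) (w : N) : Z := (completions (8 * k) w)%:R.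

Lemma completionsZ_rec k w :
  completionsZ k.+1 w = \sum_(q <- advance w) completionsZ k q.
Proof. by rewrite /completionsZ completions_advance natr_sum. Qed.

(** The product of the sparse transfer matrix with [v], written with the operations of [Z] so that
    it evaluates quickly. *)
Definition next (v : seq Z) : seq Z :=
  [seq foldr (fun i => Z.add (nth Z0 v i)) Z0 s | s <- successors].

Definition initial : seq Z :=
  [seq if w is N0 then Zpos xH else Z0 | w <- states].

Definition tables : seq (seq Z) := traject next initial 64.

Lemma tablesE k : (k < 64)%N ->
  nth [::] tables k = [seq completionsZ k w | w <- states].
Proof.
move=> k64; rewrite (set_nth_default initial) ?size_traject //.
rewrite nth_traject //; elim: k {k64} => [|k IHk].
  by apply: eq_map => -[].
rewrite iterS IHk /next successorsE -map_comp; apply/eq_in_map => w ws.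
rewrite completionsZ_rec /comp; set F := (fun i => _).
elim: (advance w) (states_closed ws) => [|q s IHs] qs; first by rewrite big_nil.
have -> : foldr F Z0 [seq index x states | x <- q :: s] =
  F (index q states) (foldr F Z0 [seq index x states | x <- s]) by [].
have qS : q \in states by rewrite qs ?mem_head.
rewrite big_cons -IHs /F => [|x xs]; last by rewrite qs // inE xs orbT.
by rewrite (nth_map N0) ?index_mem ?nth_index.
Qed.

Lemma nth_tables k w : (k < 64)%N -> w \in states ->
  nth Z0 (nth [::] tables k) (index w states) = completionsZ k w.
Proof.
by move=> k64 ws; rewrite tablesE // (nth_map N0) ?index_mem // nth_index.
Qed.

(** * The linear recurrence and the initial coefficients *)

Local Open Scope Z_scope.
Local Notation "c *t^ e" := (c, e%N) (at level 40, only parsing).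

(** [termsA] and [termsB] keep the order of the terms in [polyA] and [polyB], so that folding them
    can reproduce these sums. *)
Definition termsA : seq (Z * nat) :=
  [:: 4 *t^ 58; -5 *t^ 56; -69 *t^ 54; 34 *t^ 53; 36 *t^ 52; -28 *t^ 51;
      334 *t^ 50; -194 *t^ 49; -181 *t^ 48; 196 *t^ 47; -560 *t^ 46;
      356 *t^ 45; 490 *t^ 44; -396 *t^ 43; -22 *t^ 42; -114 *t^ 41;
      -240 *t^ 40; -44 *t^ 39; 1056 *t^ 38; -882 *t^ 37; -2511 *t^ 36;
      1742 *t^ 35; -503 *t^ 34; 2046 *t^ 33; 9154 *t^ 32; -3982 *t^ 31;
      -2114 *t^ 30; -1838 *t^ 29; -16418 *t^ 28; 4992 *t^ 27; 4087 *t^ 26;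
      592 *t^ 25; 18004 *t^ 24; -3942 *t^ 23; -3377 *t^ 22; 80 *t^ 21;
      -12769 *t^ 20; 1978 *t^ 19; 1476 *t^ 18; -90 *t^ 17; 5910 *t^ 16;
      -602 *t^ 15; -344 *t^ 14; 20 *t^ 13; -1742 *t^ 12; 98 *t^ 11; 40 *t^ 10;
      -2 *t^ 9; 306 *t^ 8; -6 *t^ 7; -2 *t^ 6; -28 *t^ 4; 1 *t^ 0].

Definition termsB : seq (Z * nat) :=
  [:: 8 *t^ 62; -13 *t^ 60; -12 *t^ 59; -133 *t^ 58; 96 *t^ 57; 103 *t^ 56;
      138 *t^ 55; 594 *t^ 54; -770 *t^ 53; -406 *t^ 52; -730 *t^ 51;
      -758 *t^ 50; 2786 *t^ 49; 820 *t^ 48; 2328 *t^ 47; -672 *t^ 46;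
      -6010 *t^ 45; 118 *t^ 44; -5192 *t^ 43; 1900 *t^ 42; 7148 *t^ 41;
      -7274 *t^ 40; 9842 *t^ 39; 2695 *t^ 38; -3132 *t^ 37; 28144 *t^ 36;
      -16280 *t^ 35; -14647 *t^ 34; -854 *t^ 33; -59822 *t^ 32; 21412 *t^ 31;
      24741 *t^ 30; -464 *t^ 29; 79992 *t^ 28; -20802 *t^ 27; -22589 *t^ 26;
      2654 *t^ 25; -70203 *t^ 24; 14230 *t^ 23; 11727 *t^ 22; -1922 *t^ 21;
      40915 *t^ 20; -6502 *t^ 19; -3185 *t^ 18; 498 *t^ 17; -15672 *t^ 16;
      1834 *t^ 15; 278 *t^ 14; -10 *t^ 13; 3807 *t^ 12; -278 *t^ 11;
      59 *t^ 10; -16 *t^ 9; -543 *t^ 8; 16 *t^ 7; -15 *t^ 6; 2 *t^ 5;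
      39 *t^ 4; 1 *t^ 2; -1 *t^ 0].

Close Scope Z_scope.

(** Two choices of [f] matter: an indicator of [n] extracts the coefficient of t^n, and [e] mapped
    to a_(n-e) gives that of the product with a series. *)
Definition lincomb (s : seq (Z * nat)) (f : nat -> Z) : Z :=
  foldr (fun ce => Z.add (Z.mul ce.1 (f ce.2))) Z0 s.

Lemma lincombE s f : lincomb s f = \sum_(ce <- s) ce.1 * f ce.2.
Proof. by rewrite unlock. Qed.

Lemma completionsZ_recurrence k w : w \in states ->
  lincomb termsB (fun e => completionsZ (k + 63 - e) w) = 0.
Proof.
have termsB_le : all (fun ce => ce.2 <= 63)%N termsB by [].
elim: k w => [|k IHk] w ws.
  (* The base case is evaluated for every state from the tables, avoiding the exponential recursion
     of [completions]. *)
  have -> : lincomb termsB (fun e => completionsZ (0 + 63 - e) w) =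
    lincomb termsB
      (fun e => nth Z0 (nth [::] tables (63 - e)) (index w states)).
    by rewrite !lincombE; apply: eq_bigr => ce _; rewrite nth_tables //; lia.
  apply/eqP; move: w ws; apply/allP.
  by vm_compute.
rewrite lincombE (eq_big_seq (fun ce =>
    \sum_(q <- advance w) ce.1 * completionsZ (k + 63 - ce.2) q)) /=;
  last first.
  (* The bound on [e] ensures that the truncated subtraction commutes with the successor. *)
  case=> c e /(allP termsB_le) /= e63; rewrite -mulr_sumr -completionsZ_rec.
  by congr (_ * completionsZ _ w); lia.
rewrite exchange_big /= big_seq big1 // => q /(states_closed ws) /IHk.
by rewrite lincombE.
Qed.

Lemma completionsZ_initial n : (n < 63)%N ->
  lincomb termsB (fun e => if (n < e)%N then Z0 else completionsZ (n - e) N0) =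
  - lincomb termsA (fun e => if e == n then Zpos xH else Z0).
Proof.
move=> n63.
have -> :
    lincomb termsB
      (fun e => if (n < e)%N then Z0 else completionsZ (n - e) N0) =
    lincomb termsB (fun e => if (n < e)%N then Z0 else
                     nth Z0 (nth [::] tables (n - e)) (index N0 states)).
  rewrite !lincombE; apply: eq_bigr => ce _; rewrite nth_tables //; lia.
apply/eqP; have : n \in iota 0 63 by rewrite mem_iota.
move: n {n63}; apply/allP.
by vm_compute.
Qed.

(** * Algebra of formal power series *)

Lemma fps_mulE (f g : fps) m n : (n < m)%N ->
  fps_mul f g n = (\poly_(i < m) f i * \poly_(i < m) g i)`_n.
Proof.
move=> nm; rewrite coefM; apply: eq_bigr => i _; rewrite !coef_poly.
by rewrite (leq_ltn_trans (leq_ord i) nm) (leq_ltn_trans (leq_subr _ _) nm).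
Qed.

(** Coefficient [n] depends only on the truncations after degree [n], so associativity is inherited
    from polynomials. *)
Lemma fps_mulA (f g h : fps) :
  fps_mul f (fps_mul g h) =1 fps_mul (fps_mul f g) h.
Proof.
move=> n; set t := fun f : fps => \poly_(i < n.+1) f i.
transitivity ((t f * (t g * t h))`_n).
  rewrite coefM; apply: eq_bigr => i _; rewrite coef_poly ltn_ord.
  by rewrite -fps_mulE // ltnS leq_subr.
rewrite mulrA coefM; apply: eq_bigr => i _.
by rewrite -fps_mulE // coef_poly ltnS leq_subr.
Qed.

Lemma fps_mul1 (f : fps) : fps_mul f (fps_of_poly 1) =1 f.
Proof.
move=> n; rewrite /fps_mul /fps_of_poly big_ord_recr /= subnn coef1 mulr1.
rewrite big1 ?add0r // => i _; rewrite coef1 subn_eq0 leqNgt ltn_ord mulr0 //.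
Qed.

Lemma fps_divP (f g h : fps) :
  g 0%N != 0 -> fps_mul f g =1 h -> f =1 fps_div h g.
Proof.
move=> g0 fg n; rewrite -[LHS]fps_mul1 /fps_div.
transitivity (fps_mul f (fps_mul g (fps_inv g)) n).
  by apply: eq_bigr => i _; rewrite fps_mulV.
by rewrite fps_mulA; apply: eq_bigr => i _; rewrite fg.
Qed.

(** * From integer term lists to rational polynomials *)

Definition ratZ : {rmorphism Z -> rat} := (intr : int -> rat) \o int_of_Z.

Definition poly_of_terms (s : seq (Z * nat)) : {poly rat} :=
  \sum_(ce <- s) ratZ ce.1 *: 'X^(ce.2).

(* Folding it over a list of terms gives polyA and polyB up to conversion. *)
Definition add_term (p : {poly rat}) (ce : Z * nat) : {poly rat} :=
  match ce.1 with
  | Z0 => p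
  | Zpos c => p + (nat_of_bin (Npos c))%:R *: 'X^(ce.2)
  | Zneg c => p - (nat_of_bin (Npos c))%:R *: 'X^(ce.2)
  end.

Lemma ratZ_pos c : ratZ (Zpos c) = (nat_of_bin (Npos c))%:R.
Proof.
have c_nat : int_of_Z (Zpos c) = Posz (nat_of_bin (Npos c)) by rewrite /=; lia.
by transitivity ((int_of_Z (Zpos c))%:~R : rat); last rewrite c_nat.
Qed.

Lemma poly_of_termsE s : poly_of_terms s = foldl add_term 0 s.
Proof.
suff H p : foldl add_term p s = p + poly_of_terms s by rewrite H add0r.
rewrite /poly_of_terms; elim: s p => [|[[|c|c] e] s IHs] p.
- by rewrite big_nil addr0.
- by rewrite big_cons rmorph0 scale0r add0r -IHs.
- by rewrite big_cons addrA ratZ_pos -IHs.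
- by rewrite big_cons addrA (rmorphN ratZ (Zpos c)) ratZ_pos scaleNr -IHs.
Qed.

Lemma polyA_terms : polyA = poly_of_terms termsA.
Proof.
(* The constant term is written as a multiple of X^0 and a leading 0 is added, to match the fold. *)
rewrite poly_of_termsE /polyA -[X in _ + X]scale1r -(expr0 'X).
rewrite -[X in X = _]add0r !addrA; exact: erefl.
Qed.

Lemma polyB_terms : polyB = poly_of_terms termsB.
Proof.
rewrite poly_of_termsE /polyB -[X in _ - X]scale1r -(expr0 'X).
rewrite -[X in X = _]add0r !addrA; exact: erefl.
Qed.

Lemma ratZ_lincomb s f :
  ratZ (lincomb s f) = \sum_(ce <- s) ratZ ce.1 * ratZ (f ce.2).
Proof.
by rewrite lincombE rmorph_sum; apply: eq_bigr => ce _; rewrite rmorphM.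
Qed.

Lemma coef_poly_of_terms s k : (poly_of_terms s)`_k =
  ratZ (lincomb s (fun e => if e == k then Zpos xH else Z0)).
Proof.
rewrite ratZ_lincomb coef_sum; apply: eq_bigr => ce _.
by rewrite coefZ coefXn eq_sym; case: eqP; rewrite (rmorph0, rmorph1).
Qed.

Lemma fps_mul_poly_of_terms (a : nat -> Z) s n :
  fps_mul (fun k => ratZ (a k)) (fps_of_poly (poly_of_terms s)) n =
  ratZ (lincomb s (fun e => if (n < e)%N then Z0 else a (n - e)%N)).
Proof.
transitivity ((\poly_(i < n.+1) ratZ (a i) * poly_of_terms s)`_n).
  by rewrite coefM; apply: eq_bigr => i _; rewrite coef_poly ltn_ord.
rewrite mulr_sumr coef_sum ratZ_lincomb; apply: eq_bigr => ce _.
rewrite -scalerAr coefZ coefMXn coef_poly ltnS leq_subr.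
by case: ifP; rewrite ?rmorph0.
Qed.

(** * The generating function and the first terms *)

Lemma completionsZ_num_tilings n : completionsZ n N0 = (num_tilings 8 n)%:R.
Proof. by rewrite num_tilingsE. Qed.

Lemma lincomb_completionsZ n :
  lincomb termsB (fun e => if (n < e)%N then Z0 else completionsZ (n - e) N0) =
  - lincomb termsA (fun e => if e == n then Zpos xH else Z0).
Proof.
have [n63|n63] := ltnP n 63; first exact: completionsZ_initial.
have termsA_lt : all (fun ce => ce.2 < 63)%N termsA by [].
have termsB_le : all (fun ce => ce.2 <= 63)%N termsB by [].
(* From t^63 on, A contributes nothing and the left side is the recurrence at [n - 63]. *)
rewrite -[RHS]/(- _) [in RHS]lincombE big_seq big1 ?oppr0; last first.
  case=> c e /(allP termsA_lt) /= e63; rewrite ifF ?mulr0 //; lia.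
have S0 : N0 \in states by vm_compute.
rewrite -(completionsZ_recurrence (n - 63) S0) !lincombE; apply: eq_big_seq.
case=> c e /(allP termsB_le) /= e63; rewrite ifF; last lia.
by rewrite subnK.
Qed.

Theorem proposition9 :
  ((fun n : nat => (num_tilings 8 n)%:R : rat)
     =1 fps_div (fps_of_poly (- polyA)) (fps_of_poly polyB))
  /\ [seq num_tilings 8 n | n <- iota 0 16]
     = [:: 1; 0; 1; 0; 12; 2; 34; 14; 250; 114; 956; 694; 5864; 4428;
           25805; 25554]%N.
Proof.
split.
  apply: fps_divP => [|n]; first by rewrite polyB_coef0 oppr_eq0 oner_eq0.
  transitivity
    (fps_mul (fun k => ratZ (completionsZ k N0)) (fps_of_poly polyB) n).
    by apply: eq_bigr => i _; rewrite completionsZ_num_tilings rmorph_nat.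
  rewrite polyB_terms fps_mul_poly_of_terms lincomb_completionsZ (rmorphN ratZ).
  by rewrite -coef_poly_of_terms -polyA_terms /fps_of_poly coefN.
(* Comparing in [Z] lets the values be read off the tables. *)
apply: (inj_map (f := fun k : nat => k%:R : Z)).
  by move=> j k /eqP; rewrite Num.Theory.eqr_nat => /eqP.
rewrite -map_comp.
rewrite (_ : map _ _ = [seq nth Z0 (nth [::] tables n) (index N0 states)
                       | n <- iota 0 16]).
  by vm_compute.
apply/eq_in_map => n; rewrite mem_iota => n16.
rewrite nth_tables ?completionsZ_num_tilings //; lia.
Qed.
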